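(* Let $x_1,x_2,\dots$ be a sequence of numbers in $(-\infty,0]$ and put $\boldsymbol{x}_d:=(x_1,\dots,x_d)$. (i) If $\sum_{i=1}^\infty x_i\in(-\infty,0]$, then $$\Pr(\boldsymbol{\eta}_T\le\boldsymbol{x}_d)\xrightarrow[d\to\infty]{}\exp\left(\sum_{i=1}^\infty x_i\right)=\lim_{d\to\infty}\Pr(\boldsymbol{\eta}_1\le\boldsymbol{x}_d).$$ (ii) If $\lim_{d\to\infty}\sum_{i=1}^d x_i=-\infty$, but such that $$\limsup_{d\to\infty}\left|\frac1d\sum_{i=1}^d x_i\right|<\log 2,$$ then $$\frac{\Pr(\boldsymbol{\eta}_T\le\boldsymbol{x}_d)}{\Pr(\boldsymbol{\eta}_1\le\boldsymbol{x}_d)}\xrightarrow[d\to\infty]{}1.$$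
   Context: For each dimension $d\ge2$, let $\boldsymbol{\eta}_1,\boldsymbol{\eta}_2,\dots$ be independent copies of a $d$-dimensional random vector $\boldsymbol{\eta}$ with independent components $\eta_1,\dots,\eta_d$, each following the standard negative exponential distribution, i.e. $\Pr(\eta_i\le x)=\exp(x)$ for $x\le0$. (The dependence on $d$ is suppressed in the notation.) Inequalities between vectors are componentwise. $\boldsymbol{\eta}_m$ is a complete record if each of its components is a record, i.e. $\boldsymbol{\eta}_m>\max_{1\le i\le m-1}\boldsymbol{\eta}_i$ (strict inequality in every component, maximum taken componentwise); $\boldsymbol{\eta}_1$ is a complete record by definition. $T=T(d):=\sup\{m\in\mathbb{N}:\boldsymbol{\eta}_m\text{ is a complete record}\}$ is the random index of the terminal complete record in dimension $d$; it is finite almost surely for $d\ge2$. *)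

(* Defs.v *)
From HB Require Import structures.
From mathcomp Require Import all_boot all_order all_algebra.
From mathcomp Require Import all_classical all_reals all_analysis.

Set Implicit Arguments.
Unset Strict Implicit.
Unset Printing Implicit Defensive.

Import Order.TTheory GRing.Theory Num.Theory.
Import numFieldNormedType.Exports.

Local Open Scope classical_set_scope.
Local Open Scope ring_scope.

(* Every index set starting at 1 is shifted to start at 0: [eta m] is the
   vector eta_{m+1}, its components are indexed by ['I_d], [x k] is the number
   x_{k+1}, and [terminal_index] is T - 1. *)

Definition mutually_independent d (Omega : measurableType d) (R : realType)
    (P : probability Omega R) (I : eqType) d' (E : measurableType d')
    (X : I -> Omega -> E) : Prop :=
  forall (J : seq I) (A : I -> set E), uniq J ->
    (forall i, measurable (A i)) ->
    P (\bigcap_(i in [set` J]) (X i @^-1` A i))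
      = (\prod_(i <- J) P (X i @^-1` A i))%E.

Definition standard_negexp d (Omega : measurableType d) (R : realType)
    (P : probability Omega R) (X : Omega -> R) : Prop :=
  forall y : R, y <= 0 -> P [set w | X w <= y] = (expR y)%:E.

Definition negexp_vector d (Omega : measurableType d) (R : realType)
    (P : probability Omega R) (n : nat) (X : {RV P >-> n.-tuple R}) : Prop :=
  mutually_independent P (fun (j : 'I_n) (w : Omega) => tnth (X w) j) /\
  forall j : 'I_n, standard_negexp P (fun w => tnth (X w) j).

Definition iid_copies d (Omega : measurableType d) (R : realType)
    (P : probability Omega R) d' (E : measurableType d')
    (X : nat -> {RV P >-> E}) : Prop :=
  mutually_independent P X /\
  forall (m : nat) (A : set E), measurable A ->
    distribution P (X m) A = distribution P (X 0%N) A.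

Section Records.
Context (Omega : Type) (R : realType) (n : nat)
  (eta : nat -> Omega -> n.-tuple R).

(* The empty maximum is -oo, so the first vector is a complete record. *)
Definition complete_record (w : Omega) (m : nat) : Prop :=
  forall j : 'I_n,
    (\big[maxe/-oo]_(k < m) (tnth (eta k w) j)%:E < (tnth (eta m w) j)%:E)%E.

Definition terminal_index (w : Omega) : \bar R :=
  ereal_sup [set m%:R%:E | m in complete_record w].

Definition vector_le (v : n.-tuple R) (x : nat -> R) : Prop :=
  forall j : 'I_n, tnth v j <= x j.

(* The event that the terminal complete record is at most x. Outcomes with
   infinite [terminal_index], a null set for n >= 2, are left out. *)
Definition terminal_record_le (x : nat -> R) : set Omega :=
  [set w | exists m : nat,
     terminal_index w = m%:R%:E /\ vector_le (eta m w) x].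

Definition first_vector_le (x : nat -> R) : set Omega :=
  [set w | vector_le (eta 0%N w) x].

End Records.

(* Main.v *)
Require Import Defs.
From HB Require Import structures.
From mathcomp Require Import all_boot all_order all_algebra.
From mathcomp Require Import all_classical all_reals all_analysis.
From mathcomp Require Import ring lra.
Import Order.TTheory GRing.Theory Num.Theory.
Import numFieldNormedType.Exports.
Local Open Scope classical_set_scope.
Local Open Scope ring_scope.

(** Write G(x) for P(eta_1 <= x) = exp(x_1 + ... + x_d). A complete record
    exceeds eta_1 in every coordinate, so eta_T <= x forces eta_1 <= x.
    Conversely, if eta_1 <= x but not eta_T <= x, then some eta_(m+2) with
    m >= 0 is a complete record. Both claims therefore follow once
<<
      sum_(m >= 0) P(eta_1 <= x, eta_(m+2) is a complete record) = o(G(x)).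
>>
    Each probability in this sum is at most a product over the coordinates.
    To see it without integrals, cut the law of a coordinate of the candidate
    eta_(m+2) into N cells of mass 1/N. If the candidate lies in the cells
    t_1, ..., t_d, then every earlier vector lies below the upper ends of these
    cells; the independence of the vectors and of their coordinates bounds the
    probability of this for fixed t, and the sum over all t of the resulting
    products is a product of d sums ([prob_later_record_le]).

    The d factors, divided by those of G(x), are estimated separately.
    - For the third and later vectors (m >= 1), N = 2(m + 1) gives factors at
      most 3 / (2(m + 1)). Their d-th powers have a sum of order (3/4)^d,
      whatever x is ([record_factor_le], [sum_late_records_le]).
    - For the second vector (m = 0), N = 2 gives (1 + min(1, 1/w)) / 2 with
      w = 2 exp(x_j), which is at most w^(-1/4) ([record_factor0_le]). The
      product over j is exp(-(d log 2 + x_1 + ... + x_d) / 4), and it decays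
      exponentially exactly because the mean of the x_j stays above a constant
      larger than -log 2 ([record_error_cvg0]).

    In case (i) the mean tends to 0, in case (ii) its bound is the hypothesis,
    so that P(eta_T <= x) / G(x) tends to 1 in both cases.

    The formal indices start at 0: [eta m] stands for eta_(m+1). *)

Set Implicit Arguments.
Unset Strict Implicit.
Unset Printing Implicit Defensive.

(** * Complete records of a fixed path *)

Section RecordPaths.
Context (Omega : Type) (R : realType) (n : nat).
Implicit Types (eta : nat -> Omega -> n.-tuple R) (w : Omega) (m : nat).

Lemma complete_recordP eta w m :
  complete_record eta w m <->
  forall (j : 'I_n) (k : nat), (k < m)%N ->
    tnth (eta k w) j < tnth (eta m w) j.
Proof.
split=> [rec j k km|rec j].
  have /bigmax_ltP[_ /(_ (Ordinal km) isT)] := rec j.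
  by rewrite lte_fin.
by apply/bigmax_ltP; split=> [|k _]; rewrite ?ltNyr// lte_fin; exact: rec.
Qed.

Lemma complete_record0 eta w : complete_record eta w 0.
Proof. by apply/complete_recordP. Qed.

(** Indices are natural numbers, so a finite supremum of record indices is
    attained; the set of these indices always contains 0. *)
Lemma terminal_indexP eta w m :
  terminal_index eta w = m%:R%:E <->
  complete_record eta w m /\ forall k, (m < k)%N -> ~ complete_record eta w k.
Proof.
split=> [Tm|[rec nrec]].
  have le_m k : complete_record eta w k -> (k <= m)%N.
    move=> reck; rewrite -(ler_nat R) -lee_fin -Tm.
    by apply: ereal_sup_ubound; exists k.
  split=> [|k mk /le_m]; last by rewrite leqNgt mk.
  apply: contrapT => nrec.
  case: m => [|m] in Tm le_m nrec *; first exact: nrec (complete_record0 _ _).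
  have : (terminal_index eta w <= m%:R%:E)%E.
    apply: ge_ereal_sup => _ [k reck <-].
    rewrite lee_fin ler_nat -ltnS ltn_neqAle le_m// andbT.
    by apply: contra_notN nrec => /eqP <-.
  by rewrite Tm lee_fin ler_nat ltnn.
apply/eqP; rewrite eq_le; apply/andP; split.
  apply: ge_ereal_sup => _ [k reck <-].
  rewrite lee_fin ler_nat leqNgt; apply/negP => mk.
  exact: nrec mk reck.
by apply: ereal_sup_ubound; exists m.
Qed.

Lemma terminal_record_le_sub eta (x : nat -> R) :
  terminal_record_le eta x `<=` first_vector_le eta x.
Proof.
move=> w [m [/terminal_indexP[/complete_recordP rec _] le_x]] j.
case: m => [|m] in rec le_x *; first exact: le_x.
by apply: le_trans (le_x j); exact/ltW/rec.
Qed.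

(** Outcomes with infinitely many complete records belong to both sides, so an
    infinite terminal index is accounted for by the union. *)
Lemma first_vector_leD_sub eta (x : nat -> R) :
  first_vector_le eta x `\` terminal_record_le eta x `<=`
  \bigcup_m [set w | first_vector_le eta x w /\ complete_record eta w m.+1].
Proof.
move=> w [le_x nT]; apply: contrapT => nrec.
apply: nT; exists 0%N; split=> //; apply/terminal_indexP.
split=> [|[//|k] _ rec]; first exact: complete_record0.
by apply: nrec; exists k.
Qed.

End RecordPaths.

(** * Cutting the negative exponential law into cells of equal mass *)

Section QuantileCells.
Context (R : realType).
Implicit Types (N t : nat) (y z : R).

(** The union of the cells 0, ..., t. The last one is unbounded above: it
    includes the positive numbers, a null set, so that the cells cover the
    whole line. *)
Definition lower_cells N t : set R :=
  [set y | (t.+1 < N)%N -> y <= ln (t.+1%:R / N%:R)].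

Definition cell N t : set R :=
  if t is t'.+1 then lower_cells N t `\` lower_cells N t' else lower_cells N t.

Lemma lower_cells_le N t y z : lower_cells N t y -> z <= y -> lower_cells N t z.
Proof. by move=> Ly zy /Ly; apply: le_trans. Qed.

Lemma cell_sub_lower N t : cell N t `<=` lower_cells N t.
Proof. by case: t => [|t] // y []. Qed.

Lemma cell_cover N y : (0 < N)%N -> exists t : 'I_N, cell N t y.
Proof.
move=> N0.
have exL : exists t, `[< lower_cells N t y >].
  by exists N; apply/asboolP; rewrite /lower_cells/= ltnNge leqnSn.
have [t /asboolP Lt t_min] := ex_minnP exL.
have tN : (t < N)%N.
  rewrite (leq_ltn_trans (t_min N.-1 _)) ?prednK//.
  by apply/asboolP; rewrite /lower_cells/= prednK// ltnn.
exists (Ordinal tN) => /=; case: t => [//|t] in Lt t_min tN *.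
split=> // /asboolP/t_min; by rewrite ltnn.
Qed.

Lemma measurable_lower_cells N t : measurable (lower_cells N t).
Proof.
rewrite (_ : lower_cells N t =
  if (t.+1 < N)%N then `]-oo, ln (t.+1%:R / N%:R)]%classic else setT).
  by case: ifP => _.
rewrite /lower_cells; case: ifP => tN; apply/seteqP; split=> y //=.
by move/(_ isT); rewrite in_itv.
Qed.

Lemma measurable_cell N t : measurable (cell N t).
Proof.
case: t => [|t]; first exact: measurable_lower_cells.
by apply: measurableD; exact: measurable_lower_cells.
Qed.

Context d (Omega : measurableType d) (P : probability Omega R)
  (X : Omega -> R) (mX : measurable_fun setT X) (X_negexp : standard_negexp P X).

Lemma prob_lower_cells N t : (t < N)%N ->
  P (X @^-1` lower_cells N t) = (t.+1%:R / N%:R)%:E.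
Proof.
rewrite leq_eqVlt => /predU1P[<-|tN].
  rewrite divff// (_ : _ @^-1` _ = setT) ?probability_setT//.
  by apply/seteqP; split=> w //= _; rewrite /lower_cells/= ltnn.
have N0 : 0 < N%:R :> R by rewrite ltr0n (leq_trans _ tN).
rewrite (_ : _ @^-1` _ = [set w | X w <= ln (t.+1%:R / N%:R)]).
  have q0 : 0 < t.+1%:R / N%:R :> R by rewrite divr_gt0.
  rewrite X_negexp ?lnK ?posrE//.
  by rewrite ln_le0// ler_pdivrMr// mul1r ler_nat ltnW.
by apply/seteqP; split=> w /=; rewrite /lower_cells/=; [exact|].
Qed.

Lemma prob_cell N t : (t < N)%N -> P (X @^-1` cell N t) = (N%:R^-1)%:E.
Proof.
have mXL s : measurable (X @^-1` lower_cells N s).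
  by rewrite -[_ @^-1` _]setTI; apply: mX => //; exact: measurable_lower_cells.
case: t => [|t] tN; first by rewrite prob_lower_cells// mul1r.
rewrite (_ : _ @^-1` _ =
  X @^-1` lower_cells N t.+1 `\` X @^-1` lower_cells N t)//.
rewrite measureD//; last first.
  by rewrite -ge0_fin_numE// fin_num_measure.
rewrite setIidr; last first.
  move=> w /=; rewrite /lower_cells/= => /(_ tN) Xle tN2.
  have N0 : 0 < N%:R :> R by rewrite ltr0n (leq_trans _ tN).
  rewrite (le_trans Xle)// ler_ln ?posrE ?divr_gt0//.
  by rewrite ler_pM2r ?invr_gt0// ler_nat.
rewrite [X in (X - _)%E](prob_lower_cells tN).
rewrite [X in (_ - X)%E](prob_lower_cells (ltnW tN)) -EFinB -mulrBl.
by rewrite -natrB// subSnn mul1r.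
Qed.

Lemma prob_lower_cells_le N t (x : R) : (t < N)%N -> x <= 0 ->
  (P (X @^-1` (lower_cells N t `&` [set y | (y <= x)%R])) <=
   (Num.min (expR x) (t.+1%:R / N%:R))%:E)%E.
Proof.
move=> tN x0.
have mXL s : measurable (X @^-1` lower_cells N s).
  by rewrite -[_ @^-1` _]setTI; apply: mX => //; exact: measurable_lower_cells.
have mXx : measurable (X @^-1` [set y | y <= x]).
  by rewrite -[_ @^-1` _]setTI -set_itvNyc; apply: mX.
rewrite EFin_min le_min -(X_negexp x0) -(prob_lower_cells tN) preimage_setI.
by apply/andP; split; apply: le_measure; rewrite ?inE//; exact: measurableI.
Qed.

End QuantileCells.

(** * Independence of vectors and coordinates *)

Lemma measure_bigsetU_le (R : realType) d (T : measurableType d)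
    (mu : {measure set T -> \bar R}) (I : Type) (r : seq I) (F : I -> set T) :
  (forall i, measurable (F i)) ->
  (mu (\big[setU/set0]_(i <- r) F i) <= \sum_(i <- r) mu (F i))%E.
Proof.
move=> mF; elim: r => [|i r IHr]; first by rewrite !big_nil measure0.
rewrite !big_cons; apply: le_trans (measureU2 mu (mF i) _) _.
  exact: bigsetU_measurable.
exact: leeD.
Qed.

Lemma prode_le (R : realDomainType) (I : Type) (r : seq I) (f : I -> \bar R)
    (g : I -> R) :
  (forall i, 0 <= f i <= (g i)%:E)%E ->
  (\prod_(i <- r) f i <= (\prod_(i <- r) g i)%:E)%E.
Proof.
move=> fg; elim: r => [|i r IHr]; first by rewrite !big_nil.
have /andP[f0 fgi] := fg i.
rewrite !big_cons EFinM lee_pmul// prode_ge0// => k _.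
by have /andP[] := fg k.
Qed.

Section Boxes.
Context (R : realType) (n : nat).

Definition box (B : 'I_n -> set R) : set (n.-tuple R) :=
  [set v | forall j, B j (tnth v j)].

Lemma measurable_box (B : 'I_n -> set R) :
  (forall j, measurable (B j)) -> measurable (box B).
Proof.
move=> mB; rewrite (_ : box B = \bigcap_(j in setT) ((@tnth n R)^~ j @^-1` B j)).
  apply: fin_bigcap_measurable => // j _.
  by rewrite -[_ @^-1` _]setTI; apply: measurable_tnth.
by apply/seteqP; split=> v /= Bv j; [move=> _|]; exact: Bv.
Qed.

Context d (Omega : measurableType d) (P : probability Omega R).

Lemma measurable_preimage_box (X : {RV P >-> n.-tuple R}) (B : 'I_n -> set R) :
  (forall j, measurable (B j)) -> measurable (X @^-1` box B).
Proof.
move=> mB; rewrite -[_ @^-1` _]setTI.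
have mX := @measurable_funPT _ _ _ _ X.
by apply: mX => //; exact: measurable_box.
Qed.

Lemma prob_box (X : {RV P >-> n.-tuple R}) (B : 'I_n -> set R) :
  negexp_vector X -> (forall j, measurable (B j)) ->
  P (X @^-1` box B) = (\prod_j P ((fun w => tnth (X w) j) @^-1` B j))%E.
Proof.
move=> [X_indep _] mB.
have := X_indep (enum 'I_n) B (enum_uniq _) mB.
rewrite big_enum/= => <-; congr (P _).
apply/seteqP; split=> w /= Bw j; [move=> _|]; first exact: Bw.
by apply: Bw; rewrite /= mem_enum.
Qed.

Lemma prob_boxes (X : nat -> {RV P >-> n.-tuple R}) m
    (B : nat -> 'I_n -> set R) :
  iid_copies X -> negexp_vector (X 0%N) -> (forall k j, measurable (B k j)) ->
  P [set w | forall k, (k < m)%N -> box (B k) (X k w)] =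
  (\prod_(k < m) \prod_j P ((fun w => tnth (X 0%N w) j) @^-1` B k j))%E.
Proof.
move=> [X_indep X_id] X_negexp mB.
have := X_indep (iota 0 m) (fun k => box (B k)) (iota_uniq _ _)
  (fun k => measurable_box (mB k)).
rewrite (_ : \bigcap_(i in _) _ =
    [set w | forall k, (k < m)%N -> box (B k) (X k w)]).
  move=> ->; rewrite -{1}(subn0 m) -/(index_iota 0 m) big_mkord.
  apply: eq_bigr => k _; rewrite -prob_box//.
  exact: X_id (measurable_box (mB k)).
apply/seteqP; split=> w /= Bw k.
  by move=> km; apply: Bw; rewrite /= mem_iota.
by rewrite /= mem_iota => /Bw.
Qed.

Lemma measurable_coord (X : {RV P >-> n.-tuple R}) (j : 'I_n) :
  measurable_fun setT (fun w => tnth (X w) j).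
Proof.
have mX := @measurable_funPT _ _ _ _ X.
exact: (measurableT_comp (measurable_tnth j) mX).
Qed.

End Boxes.

(** * The probability of a later complete record *)

Section RecordProbabilities.
Context (R : realType) d (Omega : measurableType d) (P : probability Omega R)
  (n : nat) (eta : nat -> {RV P >-> n.-tuple R}).
Implicit Types (x : nat -> R) (m : nat).

Lemma measurable_vector_le m x : measurable [set w | vector_le (eta m w) x].
Proof.
rewrite (_ : mkset _ = eta m @^-1` box (fun j : 'I_n => `]-oo, x j]%classic)).
  by apply: measurable_preimage_box => j; exact: measurable_itv.
by apply/seteqP; split=> w /= + j => /(_ j); rewrite /= in_itv.
Qed.

Lemma measurable_complete_record m :
  measurable [set w | complete_record eta w m].
Proof.
rewrite (_ : mkset _ = \bigcap_(j in [set: 'I_n]) \bigcap_(k in `I_m)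
    [set w | tnth (eta k w) j < tnth (eta m w) j]).
  apply: fin_bigcap_measurable => // j _.
  apply: fin_bigcap_measurable => // k _.
  have := measurable_realfun.measurable_fun_ltr (measurable_coord (eta k) j)
                             (measurable_coord (eta m) j).
  by move=> /(_ measurableT [set true]); rewrite setTI; exact.
apply/seteqP; split=> w.
  by move=> /complete_recordP rec j _ k /= km; exact: rec.
by move=> rec; apply/complete_recordP => j k km; exact: (rec j I k km).
Qed.

Lemma measurable_terminal_record_le x :
  measurable (terminal_record_le eta x).
Proof.
rewrite (_ : terminal_record_le _ _ = \bigcup_m
  (([set w | complete_record eta w m] `&` [set w | vector_le (eta m w) x]) `&`
   \bigcap_k ~` [set w | (m < k)%N /\ complete_record eta w k])).
  apply: bigcup_measurable => m _; apply: measurableI.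
    apply: measurableI; [exact: measurable_complete_record|].
    exact: measurable_vector_le.
  apply: bigcap_measurable => // k _; apply: measurableC.
  case: (ltnP m k) => mk.
    rewrite (_ : mkset _ = [set w | complete_record eta w k]).
      exact: measurable_complete_record.
    by apply/seteqP; split=> w //= [].
  by rewrite (_ : mkset _ = set0)// -subset0 => w /= [].
apply/seteqP; split=> w.
  move=> [m [/terminal_indexP[rec nrec] le_x]]; exists m => //; split=> //.
  by move=> k _ /= [mk]; exact: nrec.
move=> [m _ [[rec le_x] nrec]]; exists m; split=> //.
apply/terminal_indexP; split=> // k mk reck; exact: (nrec k I (conj mk reck)).
Qed.

Context (eta_iid : iid_copies eta) (eta_law : negexp_vector (eta 0%N)).

Lemma prob_first_vector_le x : (forall k, x k <= 0) ->
  P (first_vector_le eta x) = (expR (series x n))%:E.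
Proof.
move=> x_le0; rewrite (_ : first_vector_le _ _ =
    eta 0%N @^-1` box (fun j : 'I_n => `]-oo, x j]%classic)); last first.
  by apply/seteqP; split=> w /= + j => /(_ j); rewrite /= in_itv.
rewrite prob_box// /series/= big_mkord expR_sum -prodEFin.
apply: eq_bigr => j _; rewrite set_itvNyc; exact: (eta_law.2 j).
Qed.

(** The upper Riemann sum, with N steps, of the integral of
    v^m min(exp(y), v) over v in [0, 1]. The integral is the probability, for a
    single coordinate, that the first of m + 2 values is at most y and the last
    one exceeds all the others; v stands for the uniform variable exp(eta) of
    the last value. *)
Definition record_factor N m (y : R) : R :=
  \sum_(t < N) N%:R^-1 * (t.+1%:R / N%:R) ^+ m *
    Num.min (expR y) (t.+1%:R / N%:R).

(** For each choice t of one cell per coordinate, let E t be the event that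
    the candidate lies in these cells, the vectors before it lie in or below
    them, and the first vector is also at most x. These events cover the event
    on the left, independence makes each P (E t) a product over the
    coordinates, and the product of sums over cells on the right expands into
    the sum of these products over all t. *)
Lemma prob_later_record_le N m x : (0 < N)%N -> (forall k, x k <= 0) ->
  (P [set w | first_vector_le eta x w /\ complete_record eta w m.+1] <=
   (\prod_(j < n) record_factor N m (x j))%:E)%E.
Proof.
move=> N0 x_le0.
pose B (t : {ffun 'I_n -> 'I_N}) k (j : 'I_n) : set R :=
  if k is 0%N then lower_cells N (t j) `&` [set y | y <= x j]
  else if k == m.+1 then cell N (t j) else lower_cells N (t j).
have mB t k j : measurable (B t k j).
  case: k => [|k] /=; last by case: ifP => _;
    [exact: measurable_cell|exact: measurable_lower_cells].
  by apply: measurableI; [exact: measurable_lower_cells|rewrite -set_itvNyc].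
pose E t := [set w | forall k, (k < m.+2)%N -> box (B t k) (eta k w)].
have mE t : measurable (E t).
  rewrite (_ : E t = \bigcap_(k in `I_m.+2) eta k @^-1` box (B t k)).
    apply: fin_bigcap_measurable => // k _.
    exact: measurable_preimage_box.
  by apply/seteqP; split.
have cover : [set w | first_vector_le eta x w /\ complete_record eta w m.+1]
    `<=` \big[setU/set0]_t E t.
  move=> w [le_x /complete_recordP rec].
  have /choice[t Ct] : forall j, exists t : 'I_N, cell N t (tnth (eta m.+1 w) j).
    by move=> j; exact: cell_cover.
  rewrite -bigcup_seq; exists (finfun t); first by rewrite /= mem_index_enum.
  move=> k km j; have Lt := cell_sub_lower (Ct j).
  case: k => [|k] /= in km *; rewrite ffunE.
    by split=> //; apply: lower_cells_le Lt _; exact/ltW/rec.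
  rewrite eqSS; have [->//|km'] := eqVneq k m.
  apply: lower_cells_le Lt _; apply/ltW/rec.
  by rewrite ltnS ltn_neqAle km' -ltnS.
have mA : measurable
    [set w | first_vector_le eta x w /\ complete_record eta w m.+1].
  by apply: measurableI; [exact: measurable_vector_le|
    exact: measurable_complete_record].
have mU : measurable (\big[setU/set0]_t E t) by exact: bigsetU_measurable.
have /le_trans := le_measure P (mem_set mA) (mem_set mU) cover; apply.
apply: le_trans (measure_bigsetU_le P _ mE) _.
rewrite bigA_distr_bigA -sumEFin; apply: lee_sum => t _.
rewrite [leLHS](prob_boxes _ eta_iid eta_law (mB t)) exchange_big/=.
apply: prode_le => j; apply/andP; split.
  by apply: prode_ge0.
rewrite big_ord_recl big_ord_recr/=.
(* The factors are the first vector, the m vectors in between and the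
   candidate. *)
rewrite [leRHS](_ : _ = ((Num.min (expR (x j)) ((t j).+1%:R / N%:R))%:E *
    (((t j).+1%:R / N%:R) ^+ m * N%:R^-1)%:E)%E); last first.
  by rewrite -EFinM mulrC (mulrC N%:R^-1).
have mX := measurable_coord (eta 0%N) j.
have X_negexp : standard_negexp P (fun w => tnth (eta 0%N w) j).
  exact: eta_law.2.
apply: lee_pmul => //; first by rewrite mule_ge0// prode_ge0.
  exact: prob_lower_cells_le.
rewrite EFinM; apply: lee_pmul => //; first by rewrite prode_ge0.
  rewrite -[m in leRHS]card_ord -prodr_const; apply: prode_le => k.
  rewrite /bump/= add1n eqSS ltn_eqF//; apply/andP; split=> //.
  by rewrite [leLHS](prob_lower_cells X_negexp).
by rewrite /bump/= add1n eqxx [leLHS](prob_cell mX X_negexp).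
Qed.

End RecordProbabilities.

(** * Estimates of the coordinate factors *)

Section FactorBounds.
Context (R : realType).
Implicit Types (N m : nat) (y : R).

(** The terms but the last sum up to at most the integral of v^m over [0, N], by
    comparing m.+1 a^m with the increment of a^m.+1. *)
Lemma sum_pow_le N m :
  \sum_(t < N) t.+1%:R ^+ m <= N%:R ^+ m.+1 / m.+1%:R + N%:R ^+ m :> R.
Proof.
have pow_succ a : 0 <= a -> m.+1%:R * a ^+ m <= (a + 1) ^+ m.+1 - a ^+ m.+1 :> R.
  move=> a0; elim: m => [|k IHk]; first by rewrite !expr1 expr0; lra.
  have ak : a ^+ k.+1 <= (a + 1) ^+ k.+1 by rewrite lerXn2r ?nnegrE//; lra.
  have := ler_wpM2l a0 IHk.
  rewrite (exprS _ k.+1) (exprS a k.+1) [in k.+2%:R]mulrSr exprS in ak *.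
  nra.
elim: N => [|N IHN].
  by rewrite big_ord0 addr_ge0 ?divr_ge0 ?exprn_ge0.
rewrite big_ord_recr/= lerD2r (le_trans IHN)//.
rewrite -(natr1 N).
have : N%:R ^+ m <= ((N%:R + 1) ^+ m.+1 - N%:R ^+ m.+1) / m.+1%:R :> R.
  by rewrite ler_pdivlMr// mulrC; exact: pow_succ.
by rewrite mulrBl lerBrDl.
Qed.

(** With s^4 = 2 exp(y) the claim reads 1 + s^4 <= 2 s^3 when s >= 1, which is
    (s - 1) (s^3 - s^2 - s - 1) <= 0 and holds up to s = 3/2; for s <= 1 the
    right-hand side is at least exp(y). The exponential form on the right turns
    the product over the coordinates into a function of the sum of the y's. *)
Lemma record_factor0_le y : y <= 0 ->
  record_factor 2 0 y <= expR y * expR (- ((ln 2 + y) / 4)).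
Proof.
move=> y0; rewrite /record_factor !big_ord_recl big_ord0/=.
rewrite !expr0 !mulr1 addr0 divff//.
have y1 : expR y <= 1 by rewrite -expR0 ler_expR.
rewrite (min_l y1) -mulrDr.
have u0 := expR_gt0 y.
pose s := expR ((ln 2 + y) / 4).
have s0 : 0 < s by exact: expR_gt0.
have s4 : s ^+ 4 = 2 * expR y.
  rewrite -expRM_natr -mulrA mulVf ?pnatr_eq0// mulr1 expRD lnK// posrE.
  by rewrite ltr0n.
rewrite expRN -/s ler_pdivlMr//.
rewrite /bump/= ?mul1r.
have [u2|u2] := leP (expR y) (2^-1).
  have s1 : s <= 1.
    rewrite leNgt; apply/negP => s1.
    have : 1 < s ^+ 4 by rewrite exprn_egt1.
    by rewrite s4; lra.
  nra.
have s1 : 1 < s.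
  rewrite ltNge; apply/negP => s1.
  have : s ^+ 4 <= 1 by rewrite exprn_ile1// ltW.
  by rewrite s4; lra.
have s3 : s ^+ 3 <= s ^+ 2 + s + 1.
  (* s^4 <= 2 < (3/2)^4 *)
  have : s <= 3/2.
    rewrite leNgt; apply/negP => s32.
    have : (3/2) ^+ 4 < s ^+ 4 by rewrite ltrXn2r// ?nnegrE; lra.
    by rewrite s4; lra.
  by rewrite !exprS expr0; nra.
have -> : expR y = s ^+ 4 / 2 by rewrite s4 mulrC mulKf.
have : (s - 1) * (s ^+ 3 - s ^+ 2 - s - 1) <= 0.
  by rewrite mulr_ge0_le0//; lra.
by move=> /(ler_wpM2l (ltW s0)); lra.
Qed.

(** Dropping the cell from the minimum leaves exp(y) (1 / m.+1 + 1 / N); the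
    number of cells grows with m so that the error 1 / N of the Riemann sum
    stays comparable to the main term. *)
Lemma record_factor_le m y :
  record_factor (2 * m.+1) m y <= expR y * (3 / (2 * m.+1%:R)).
Proof.
set N := (2 * m.+1)%N.
have N0 : N%:R != 0 :> R by rewrite pnatr_eq0.
have -> : 3 / (2 * m.+1%:R) =
    (N%:R ^+ m.+1)^-1 * (N%:R ^+ m.+1 / m.+1%:R + N%:R ^+ m) :> R.
  rewrite mulrDr mulKf ?expf_neq0// exprS (invfM N%:R) mulfVK ?expf_neq0//.
  by rewrite /N natrM; field; rewrite addrC natr1 pnatr_eq0.
apply: le_trans (_ : expR y * ((N%:R ^+ m.+1)^-1 * \sum_(t < N) t.+1%:R ^+ m) <= _).
  rewrite mulrA mulr_sumr ler_sum// => t _.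
  rewrite [leRHS](_ : _ = N%:R^-1 * (t.+1%:R / N%:R) ^+ m * expR y).
    by rewrite ler_wpM2l ?ge_min ?lexx// mulr_ge0 ?exprn_ge0 ?divr_ge0 ?invr_ge0.
  by rewrite exprMn exprVn exprS invfM; ring.
by rewrite ler_wpM2l ?expR_ge0// ler_wpM2l ?sum_pow_le// invr_ge0 exprn_ge0.
Qed.

Lemma record_factor_ge0 N m (y : R) : 0 <= record_factor N m y.
Proof.
apply: sumr_ge0 => t _.
by rewrite mulr_ge0 ?mulr_ge0 ?exprn_ge0 ?divr_ge0 ?invr_ge0// le_min expR_ge0/=
  divr_ge0.
Qed.

(** Two of the n factors of each term make the sum converge, by comparison with
    the telescoping series of 1 / (m.+1 m.+2); the others are at most 3/4. *)
Lemma sum_late_records_le (n M : nat) : (2 <= n)%N ->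
  \sum_(m < M) (3 / (2 * m.+2%:R)) ^+ n <= 4 * (3 / 4) ^+ n :> R.
Proof.
move=> n2.
have term_le m : (3 / (2 * m.+2%:R)) ^+ n <=
    4 * (3 / 4) ^+ n * (m.+1%:R^-1 - m.+2%:R^-1) :> R.
  rewrite -(subnK n2) !exprD.
  have q0 : 0 <= 3 / (2 * m.+2%:R) :> R by rewrite divr_ge0 ?mulr_ge0.
  have q34 : 3 / (2 * m.+2%:R) <= 3 / 4 :> R.
    rewrite ler_pM2l// lef_pV2 ?posrE ?mulr_gt0//.
    have : 2 <= m.+2%:R :> R by rewrite ler_nat.
    lra.
  have pow_le : (3 / (2 * m.+2%:R)) ^+ (n - 2) <= (3 / 4) ^+ (n - 2) :> R.
    by rewrite lerXn2r// nnegrE; lra.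
  rewrite -(natr1 m.+1) in q0 pow_le *; set a := m.+1%:R in q0 pow_le *.
  have a1 : 1 <= a by rewrite /a (ler_nat _ 1).
  rewrite [leRHS](_ : _ = (3 / 4) ^+ (n - 2) * (9 / 4 / (a * (a + 1)))); last first.
    by field; rewrite !gt_eqF//; lra.
  apply: ler_pM; rewrite ?exprn_ge0//.
  rewrite [leLHS](_ : _ = 9 / 4 / ((a + 1) * (a + 1))); last first.
    by field; rewrite gt_eqF//; lra.
  rewrite ler_pM2l; last lra.
  by rewrite lef_pV2 ?posrE ?mulr_gt0//; try lra; nra.
apply: le_trans (_ : \sum_(m < M)
    4 * (3 / 4) ^+ n * (m.+1%:R^-1 - m.+2%:R^-1) <= _).
  by apply: ler_sum => m _; exact: term_le.
rewrite -mulr_sumr ler_piMr ?mulr_ge0 ?exprn_ge0//; try lra.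
rewrite -(big_mkord xpredT (fun m => m.+1%:R^-1 - m.+2%:R^-1)).
rewrite -[X in X <= _]opprK -sumrN.
under eq_bigr do rewrite opprB.
rewrite (telescope_sumr (fun m => m.+1%:R^-1))// opprB invr1.
by rewrite gerBl invr_ge0.
Qed.

End FactorBounds.

(** * Comparing the terminal record with the first vector *)

Section TerminalRecord.
Context (R : realType).
Implicit Types (x : nat -> R) (n : nat).

(** A bound for the conditional probability, given that the first vector is at
    most x, that there is a further complete record: the first term stems from
    the second vector, the other one from all the later vectors. *)
Definition record_error n x : R :=
  expR (- ((n%:R * ln 2 + series x n) / 4)) + 4 * (3 / 4) ^+ n.

Context d (Omega : measurableType d) (P : probability Omega R)
  (n : nat) (eta : nat -> {RV P >-> n.-tuple R}) (n2 : (2 <= n)%N)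
  (eta_iid : iid_copies eta) (eta_law : negexp_vector (eta 0%N))
  (x : nat -> R) (x_le0 : forall k, x k <= 0).

Lemma prod_expR : \prod_(j < n) expR (x j) = expR (series x n).
Proof. by rewrite /series/= big_mkord expR_sum. Qed.

Lemma prob_second_record_le :
  (P [set w | first_vector_le eta x w /\ complete_record eta w 1] <=
   (expR (series x n) * expR (- ((n%:R * ln 2 + series x n) / 4)))%:E)%E.
Proof.
apply: le_trans
  (@prob_later_record_le _ _ _ _ _ _ eta_iid eta_law 2 0 x isT x_le0) _.
rewrite lee_fin.
apply: le_trans (_ : \prod_(j < n) (expR (x j) * expR (- ((ln 2 + x j) / 4))) <= _).
  by apply: ler_prod => j _; rewrite record_factor_ge0 record_factor0_le.
rewrite big_split/= prod_expR -expR_sum sumrN -mulr_suml big_split/=.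
by rewrite sumr_const card_ord -(mulr_natl (ln 2)) /series/= big_mkord.
Qed.

Lemma prob_late_record_le m :
  (P [set w | first_vector_le eta x w /\ complete_record eta w m.+2] <=
   (expR (series x n) * (3 / (2 * m.+2%:R)) ^+ n)%:E)%E.
Proof.
have N0 : (0 < 2 * m.+2)%N by [].
apply: le_trans
  (@prob_later_record_le _ _ _ _ _ _ eta_iid eta_law _ m.+1 x N0 x_le0) _.
rewrite lee_fin.
apply: le_trans (_ : \prod_(j < n) (expR (x j) * (3 / (2 * m.+2%:R))) <= _).
  by apply: ler_prod => j _; rewrite record_factor_ge0 record_factor_le.
by rewrite big_split/= prod_expR prodr_const card_ord.
Qed.

Lemma prob_not_terminal_le :
  (P (first_vector_le eta x `\` terminal_record_le eta x) <=
   (expR (series x n) * record_error n x)%:E)%E.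
Proof.
have mF : measurable (first_vector_le eta x) by exact: measurable_vector_le.
have mT := measurable_terminal_record_le eta x.
have mA m : measurable
    [set w | first_vector_le eta x w /\ complete_record eta w m.+1].
  by apply: measurableI; [exact: mF|exact: measurable_complete_record].
apply: le_trans (measure_sigma_subadditive P mA (measurableD mF mT)
  (@first_vector_leD_sub _ _ _ _ _)) _.
apply: lime_le; first exact: is_cvg_nneseries.
apply: nearW => -[|M].
  by rewrite big_geq// lee_fin mulr_ge0 ?expR_ge0 ?addr_ge0 ?mulr_ge0 ?exprn_ge0.
rewrite big_nat_recl// mulrDr EFinD leeD//; first exact: prob_second_record_le.
rewrite big_mkord.
apply: le_trans (_ : (\sum_(m < M)
    (expR (series x n) * (3 / (2 * m.+2%:R)) ^+ n)%:E <= _)%E).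
  by apply: lee_sum => m _; exact: prob_late_record_le.
by rewrite sumEFin lee_fin -mulr_sumr ler_wpM2l ?expR_ge0// sum_late_records_le.
Qed.

Lemma prob_terminal_record_le :
  exists2 p, P (terminal_record_le eta x) = p%:E &
    expR (series x n) * (1 - record_error n x) <= p <= expR (series x n).
Proof.
have mF : measurable (first_vector_le eta x) by exact: measurable_vector_le.
have mT := measurable_terminal_record_le eta x.
have PF := prob_first_vector_le eta_law x_le0.
have [p PT] : exists p, P (terminal_record_le eta x) = p%:E.
  by exists (fine (P (terminal_record_le eta x))); rewrite fineK// fin_num_measure.
exists p => //; apply/andP; split.
  have := prob_not_terminal_le.
  rewrite measureD//; last by rewrite -ge0_fin_numE// fin_num_measure.
  rewrite setIidr; last exact: terminal_record_le_sub.
  rewrite [X in (X - _)%E]PF [X in (_ - X)%E]PT -EFinB lee_fin; lra.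
rewrite -lee_fin -PT -PF.
exact: le_measure (mem_set mT) (mem_set mF) (@terminal_record_le_sub _ _ _ _ _).
Qed.

End TerminalRecord.

(** * Passage to the limit *)

Section Limits.
Context (R : realType).
Implicit Types (x : nat -> R) (s c : R).

Lemma record_error_cvg0 x c : c < ln 2 ->
  (\forall n \near \oo, - (c * n%:R) <= series x n) ->
  record_error n x @[n --> \oo] --> (0 : R).
Proof.
move=> c2 x_ge; rewrite -[0]addr0; apply: cvgD.
  pose r := expR (- ((ln 2 - c) / 4)).
  have r1 : `|r| < 1.
    by rewrite ger0_norm ?expR_ge0// -expR0 ltr_expR; lra.
  apply: (squeeze_cvgr _ (cvg_cst 0) (cvg_geometric 1 r1)).
  near=> n; rewrite expR_ge0/= mul1r -expRM_natr ler_expR.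
  have : - (c * n%:R) <= series x n by near: n.
  lra.
have q1 : `|3 / 4 : R| < 1 by rewrite ger0_norm; lra.
exact: (cvg_geometric 4 q1).
Unshelve. all: by end_near. Qed.

Lemma series_ge_of_cvg x s : series x @ \oo --> s ->
  \forall n \near \oo, - (ln 2 / 2 * n%:R) <= series x n.
Proof.
move=> xs; have l2 : 0 < ln 2 :> R by rewrite ln_gt0// ltr1n.
near=> n.
have : s - 1 < series x n.
  by near: n; apply: (cvgr_gt s xs); lra.
have : (1 - s) / (ln 2 / 2) <= n%:R by near: n; exact: nbhs_infty_ger.
rewrite ler_pdivrMr; last lra.
lra.
Unshelve. all: by end_near. Qed.

(** The limes superior is an infimum of suprema over tails, so one of these
    suprema lies below ln 2; it serves as c. *)
Lemma series_ge_of_limn_esup x :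
  (limn_esup (fun n => (`|n%:R^-1 * series x n|)%:E) < (ln 2)%:E)%E ->
  exists2 c, c < ln 2 & \forall n \near \oo, - (c * n%:R) <= series x n.
Proof.
rewrite /limn_esup limf_esupE => /ereal_inf_lt[_ [A A_oo <-]].
set u := (fun n => _); move=> supA.
have [k Ak] : exists k, A k.
  by have [N _ NA] := A_oo; exists N; apply: NA => /=.
have le_sup i : A i -> (u i <= ereal_sup (u @` A))%E.
  by move=> Ai; apply: ereal_sup_ubound; exists i.
have sup_fin : ereal_sup (u @` A) \is a fin_num.
  rewrite ge0_fin_numE; first exact: lt_trans supA (ltry _).
  by apply: le_trans (le_sup _ Ak); rewrite lee_fin.
exists (fine (ereal_sup (u @` A))).
  by rewrite -lte_fin fineK.
near=> n.
have n0 : 0 < n%:R :> R by near: n; exact: nbhs_infty_gtr.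
have : (u n <= ereal_sup (u @` A))%E by apply: le_sup; near: n.
rewrite -(fineK sup_fin) lee_fin /u normrM ger0_norm ?invr_ge0//.
rewrite ler_pdivrMl// mulrC -normrN => /(le_trans (ler_norm _)).
by rewrite lerNl fineK.
Unshelve. all: by end_near. Qed.

End Limits.

Unset Implicit Arguments.

Theorem proposition2p3 (R : realType)
  (disp : nat -> measure_display)
  (Omega : forall d : nat, measurableType (disp d))
  (P : forall d : nat, probability (Omega d) R)
  (eta : forall d : nat, nat -> {RV (P d) >-> d.-tuple R})
  (eta_iid : forall d : nat, (2 <= d)%N -> iid_copies (eta d))
  (eta_law : forall d : nat, (2 <= d)%N -> negexp_vector (eta d 0%N))
  (x : nat -> R)
  (x_le0 : forall k : nat, x k <= 0) :
  (forall s : R, s <= 0 -> series x @ \oo --> s ->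
     P d (terminal_record_le (eta d) x) @[d --> \oo] --> (expR s)%:E /\
     P d (first_vector_le (eta d) x) @[d --> \oo] --> (expR s)%:E) /\
  (series x @ \oo --> -oo ->
   (limn_esup (fun d : nat => (`|d%:R^-1 * series x d|)%:E) < (ln 2)%:E)%E ->
     fine (P d (terminal_record_le (eta d) x)) /
     fine (P d (first_vector_le (eta d) x)) @[d --> \oo] --> (1 : R)).
Proof.
have first_eq d : (2 <= d)%N ->
    P d (first_vector_le (eta d) x) = (expR (series x d))%:E.
  by move=> d2; exact: (prob_first_vector_le (eta_law d d2) x_le0).
have terminal_bounds d : (2 <= d)%N ->
    exists2 p, P d (terminal_record_le (eta d) x) = p%:E &
      expR (series x d) * (1 - record_error d x) <= p <= expR (series x d).
  move=> d2.
  exact: (prob_terminal_record_le d2 (eta_iid d d2) (eta_law d d2) x_le0).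
split=> [s s0 xs|_ x_esup].
  have exp_cvg : expR (series x d) @[d --> \oo] --> expR s.
    by apply: continuous_cvg => //; exact: continuous_expR.
  have first_cvg : (expR (series x d))%:E @[d --> \oo] --> (expR s)%:E.
    by apply: cvg_EFin => //; exact: nearW.
  have err0 : record_error d x @[d --> \oo] --> (0 : R).
    apply: record_error_cvg0 (series_ge_of_cvg xs).
    have : 0 < ln 2 :> R by rewrite ln_gt0// ltr1n.
    lra.
  split; last first.
    apply: cvg_trans first_cvg; apply: near_eq_cvg.
    by near=> d; rewrite first_eq//; near: d; exact: nbhs_infty_ge.
  have low_cvg : (expR (series x d) * (1 - record_error d x))%:E @[d --> \oo]
      --> (expR s)%:E.
    apply: cvg_EFin; first exact: nearW.
    rewrite -[expR s]mulr1 -[X in _ * X]subr0.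
    by apply: cvgM => //; apply: cvgB => //; exact: cvg_cst.
  apply: (squeeze_cvge _ low_cvg first_cvg).
  near=> d; have d2 : (2 <= d)%N by near: d; exact: nbhs_infty_ge.
  by have [p -> /andP[lep pge]] := terminal_bounds d d2; rewrite !lee_fin lep.
have [c c2 x_ge] := series_ge_of_limn_esup x_esup.
have err0 := record_error_cvg0 c2 x_ge.
have low_cvg : 1 - record_error d x @[d --> \oo] --> (1 : R).
  by rewrite -[X in _ --> X]subr0; apply: cvgB => //; exact: cvg_cst.
pose ratio d := fine (P d (terminal_record_le (eta d) x)) /
  fine (P d (first_vector_le (eta d) x)).
suff ratio_bounds : \forall d \near \oo, 1 - record_error d x <= ratio d <= 1.
  by apply: (squeeze_cvgr ratio_bounds); [exact: low_cvg|exact: cvg_cst].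
near=> d; have d2 : (2 <= d)%N by near: d; exact: nbhs_infty_ge.
have [p pE /andP[lep pge]] := terminal_bounds d d2.
rewrite /ratio pE first_eq//=.
by rewrite ler_pdivlMr ?expR_gt0// ler_pdivrMr ?expR_gt0// mul1r pge mulrC lep.
Unshelve. all: by end_near. Qed.
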